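(* Let $(X,\|\cdot\|)$ be a non-trivial real Banach space with dual $X^*$. (1) For every nonempty closed convex bounded $C\subset X$, the support functionals of $C$ are strongly (i.e. with respect to the dual norm) dense in $X^*$. (2) If $C\subset X$ is merely nonempty, closed and convex, then the support functionals of $C$ are strongly dense in the domain of $\sigma_C$. In other words, for every $\epsilon>0$ and every $f\in X^*$ such that $\sup_C f<+\infty$ there are $g\in X^*$ and $x_0\in C$ such that $g(x_0)=\sup_C g$ (that is, $g\in N_C(x_0)$) and $\|f-g\|\le\epsilon$.
   Context: For $C\subset X$: $\sigma_C(x^* )=\sup_{x\in C}x^*(x)$ for $x^*\in X^*$, and the domain of $\sigma_C$ is $\{x^*\in X^*\mid\sigma_C(x^* )<+\infty\}$. The normal cone is $N_C(a)=\{a^*\in X^*\mid a^*(y-a)\le 0\ \forall y\in C\}$ if $a\in C$, $N_C(a)=\emptyset$ if $a\notin C$. The support functionals of $C$ are the elements of the range $R(N_C)=\bigcup_{a\in C}N_C(a)$, i.e. the functionals in $X^*$ that attain their supremum over $C$ at a point of $C$. *)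

(* Defs.v *)
From HB Require Import structures.
From mathcomp Require Import all_boot all_order all_algebra.
From mathcomp Require Import all_classical all_reals all_analysis.

Set Implicit Arguments.
Unset Strict Implicit.
Unset Printing Implicit Defensive.

Import Order.TTheory GRing.Theory Num.Theory.
Import numFieldNormedType.Exports.

Local Open Scope classical_set_scope.
Local Open Scope ring_scope.

Section dual.
Context {R : realType} (X : normedModType R).

Definition dual_pred : {pred X -> R^o} :=
  mem [set f : X -> R^o | linear f /\ continuous f].

Record dual_space := Dual {
  dual_fun :> X -> R^o ;
  dual_funP : dual_fun \in dual_pred }.

HB.instance Definition _ := [isSub for dual_fun].
HB.instance Definition _ := [Choice of dual_space by <:].

Lemma dual_submod_closed : submod_closed dual_pred.
Proof.
split=> [|a f g]; rewrite !inE.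
  split=> [b u v|x].
    by rewrite -[0 : X -> R^o]/(fun=> 0) scaler0 addr0.
  exact: cvg_cst.
move=> [lf cf] [lg cg]; split=> [b u v|x].
  rewrite [LHS]/(a *: f (b *: u + v) + g (b *: u + v)) lf lg.
  rewrite -[(a *: f + g) u]/(a *: f u + g u) -[(a *: f + g) v]/(a *: f v + g v).
  by rewrite !scalerDr !scalerA (mulrC a b) addrACA.
apply: cvgD; last exact: cg.
exact: cvgZl_tmp (cf x).
Qed.

HB.instance Definition _ :=
  GRing.isSubmodClosed.Build _ _ dual_pred dual_submod_closed.
HB.instance Definition _ := [SubChoice_isSubLmodule of dual_space by <:].

Lemma dual_linear (f : dual_space) : linear f.
Proof. by have := dual_funP f; rewrite inE => -[]. Qed.

Lemma dual_continuous (f : dual_space) : continuous f.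
Proof. by have := dual_funP f; rewrite inE => -[]. Qed.

HB.instance Definition _ (f : dual_space) :=
  GRing.isLinear.Build R X R^o *:%R (dual_fun f) (@dual_linear f).

Definition dual_norm (f : dual_space) : R :=
  sup [set `|f x| | x in [set x : X | `|x| <= 1]].

Lemma dual_norm_has_sup (f : dual_space) :
  has_sup [set `|f x| | x in [set x : X | `|x| <= 1]].
Proof.
split; first by exists `|f 0|, 0 => //=; rewrite normr0 ler01.
have /linear_boundedP /pinfty_ex_gt0 [M M0 fM] :
    bounded_near (f : {linear X -> R^o}) (nbhs 0).
  exact/linear_bounded_continuous/dual_continuous.
exists M => _ [x /= x1 <-]; apply: le_trans (fM x) _.
by rewrite ler_piMr// ltW.
Qed.

Lemma dual_norm_ub (f : dual_space) (x : X) : `|x| <= 1 -> `|f x| <= dual_norm f.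
Proof.
by move=> x1; apply: (sup_upper_bound (dual_norm_has_sup f)); exists x.
Qed.

Lemma dual_norm_le (f : dual_space) (M : R) :
  (forall x, `|x| <= 1 -> `|f x| <= M) -> dual_norm f <= M.
Proof.
move=> fM; apply: ge_sup; first exact: (dual_norm_has_sup f).1.
by move=> _ [x /= x1 <-]; exact: fM.
Qed.

Lemma dual_norm_ge0 (f : dual_space) : 0 <= dual_norm f.
Proof. by apply: le_trans (dual_norm_ub f (x := 0) _); rewrite ?normr0. Qed.

Lemma ler_dual_normD (f g : dual_space) :
  dual_norm (f + g) <= dual_norm f + dual_norm g.
Proof.
apply: dual_norm_le => x x1.
by rewrite (le_trans (ler_normD (f x) (g x)))// lerD// dual_norm_ub.
Qed.

Lemma dual_normZ (a : R) (f : dual_space) : dual_norm (a *: f) = `|a| * dual_norm f.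
Proof.
have le_normZ b (g : dual_space) : dual_norm (b *: g) <= `|b| * dual_norm g.
  apply: dual_norm_le => x x1.
  rewrite -[(b *: g) x]/(b *: g x) normrZ.
  by rewrite ler_wpM2l// dual_norm_ub.
apply/eqP; rewrite eq_le le_normZ/=.
have [->|a0] := eqVneq a 0; first by rewrite normr0 mul0r dual_norm_ge0.
rewrite -ler_pdivlMl ?normr_gt0// -normfV.
by rewrite -{1}[f](scalerK a0) le_normZ.
Qed.

Lemma dual_norm_eq0 (f : dual_space) : dual_norm f = 0 -> f = 0.
Proof.
move=> f0; apply/val_inj/funext => x /=; rewrite -[RHS]/(0 : R).
have [->|x0] := eqVneq x 0; first by rewrite linear0.
have xV0 : `|x|^-1 != 0 by rewrite invr_eq0 normr_eq0.
have : `|f (`|x|^-1 *: x)| <= 0.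
  rewrite -f0 dual_norm_ub// normrZ ger0_norm ?invr_ge0//.
  by rewrite mulVf// normr_eq0.
by rewrite normr_le0 linearZ scaler_eq0 (negPf xV0) => /eqP.
Qed.

(* This instance is what gives dual_space its topology: [dense] and [closure]
   on dual_space X refer to the dual norm, not to pointwise convergence. *)
HB.instance Definition _ :=
  Lmodule_isNormed.Build R dual_space ler_dual_normD dual_normZ dual_norm_eq0.

End dual.

Section support.
Context {R : realType} {X : normedModType R}.
Implicit Types (C : set X) (a : X) (f : dual_space X).

Definition support_function C f : \bar R := ereal_sup [set (f x)%:E | x in C].

Definition support_domain C : set (dual_space X) :=
  [set f | (support_function C f < +oo)%E].

Definition normal_cone C a : set (dual_space X) :=
  [set f | C a /\ forall y, C y -> f (y - a) <= 0].

Definition support_functionals C : set (dual_space X) :=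
  \bigcup_(a in C) normal_cone C a.

End support.

(* Main.v *)
Require Import Defs.
From HB Require Import structures.
From mathcomp Require Import all_boot all_order all_algebra.
From mathcomp Require Import all_classical all_reals all_analysis.
From mathcomp Require Import lra.
Import Order.TTheory GRing.Theory Num.Theory.
Import numFieldNormedType.Exports.
Local Open Scope classical_set_scope.
Local Open Scope ring_scope.

(** This is the Bishop-Phelps theorem, and everything comes down to part (2):
    a functional [f] bounded above on [C] can be moved by at most [eps] so that
    it attains its supremum over [C] ([bishop_phelps]).  When [C] is bounded,
    every functional is bounded above on [C], which gives part (1).

    Completeness of [X] enters through a variational principle
    ([ekeland_point]): although [f] may not attain its supremum on [C], there
    is a point [x0] of [C] where the perturbed function
    [f - eps * |. - x0|] does, i.e.
      [f (y - x0) <= eps * |y - x0|] for all [y] in [C].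

    It remains to replace the perturbation [eps * |. - x0|], which is only
    sublinear, by a linear one.  The inequality above says that on the convex
    cone spanned by [C - x0] the linear functional [f] is below the sublinear
    functional [eps * |.|].  By the Hahn-Banach theorem, in the form
    [hahn_banach_cone], there is a linear functional [h] that lies between the
    two: [h <= eps * |.|] everywhere, hence [|h| <= eps] in the dual, and
    [f <= h] on [C - x0].  Then [g = f - h] is nonpositive on [C - x0], that
    is, [g] attains its supremum over [C] at [x0], and [|f - g| = |h| <= eps].

    The Hahn-Banach theorem is obtained by observing that linear functionals
    are the minimal sublinear ones, minimal ones being provided by Zorn's lemma.
    A single construction, [cone_inf], serves twice: it lowers a sublinear
    functional so that its linear minorants satisfy the cone constraint, and it
    shows that a minimal sublinear functional is additive. *)

Set Implicit Arguments.
Unset Strict Implicit.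
Unset Printing Implicit Defensive.

(** * Sublinear functionals *)

Lemma le_infD (R : realType) (A B : set R) (c : R) :
  A !=set0 -> B !=set0 -> (forall a b, A a -> B b -> c <= a + b) ->
  c <= inf A + inf B.
Proof.
move=> A0 B0 cAB; rewrite -lerBlDr; apply: lb_le_inf => // a Aa.
rewrite lerBlDr -lerBlDl; apply: lb_le_inf => // b Bb.
by rewrite lerBlDl cAB.
Qed.

Section sublinear.
Context {R : realType} {X : lmodType R}.
Implicit Types (p q r : X -> R) (K : set (X * R)).

(** One inequality suffices for positive homogeneity: the converse is
    [sublinearZ]. *)
Definition sublinear q :=
  (forall u v, q (u + v) <= q u + q v) /\
  (forall t v, 0 <= t -> q (t *: v) <= t * q v).

Lemma sublinear0 q : sublinear q -> q 0 = 0.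
Proof.
move=> [qD qZ]; apply/eqP; rewrite eq_le.
have := qZ 0 0 (lexx _); rewrite scale0r mul0r => ->/=.
by have := qD 0 0; rewrite addr0; lra.
Qed.

Lemma sublinear_opp_ge q v : sublinear q -> - q (- v) <= q v.
Proof. by move=> qs; have := qs.1 v (- v); rewrite subrr sublinear0//; lra. Qed.

Lemma sublinearZ q t v : sublinear q -> 0 <= t -> q (t *: v) = t * q v.
Proof.
move=> qs; rewrite le_eqVlt => /predU1P[<-|t0].
  by rewrite scale0r mul0r sublinear0.
have := qs.2 t^-1 (t *: v); rewrite invr_ge0 scalerA mulVf ?gt_eqF// scale1r.
rewrite -ler_pdivrMl ?invr_gt0// invrK => /(_ (ltW t0)) tq.
by apply/eqP; rewrite eq_le tq qs.2 ?ltW.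
Qed.

(** The elements [(w, a)] of the cone stand for the constraints [a <= h w] on
    a linear functional [h]. *)
Definition convex_cone K :=
  [/\ K (0, 0),
      forall w1 w2, K w1 -> K w2 -> K (w1.1 + w2.1, w1.2 + w2.2) &
      forall t w, 0 <= t -> K w -> K (t *: w.1, t * w.2)].

(** Any linear [h <= q] with [a <= h w] for all [(w, a)] in [K] satisfies
    [h v = h (v + w) - h w <= q (v + w) - a]; this infimum is therefore the
    best upper bound that [q] and [K] impose on [h v]. *)
Definition cone_inf q K v : R := inf [set q (v + w.1) - w.2 | w in K].

Section cone_inf.
Variables (q : X -> R) (K : set (X * R)).
Hypotheses (qs : sublinear q) (Kc : convex_cone K).
Hypothesis Kq : forall w, K w -> w.2 <= q w.1.

Lemma cone_inf_le v w : K w -> cone_inf q K v <= q (v + w.1) - w.2.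
Proof.
move=> Kw; apply: ge_inf; last by exists w.
(* [a <= q w <= q (- v) + q (v + w)] bounds the family below. *)
exists (- q (- v)) => _ [z Kz <-].
by have := qs.1 (- v) (v + z.1); rewrite addKr; have := Kq Kz; lra.
Qed.

Lemma cone_inf_nonempty v : [set q (v + w.1) - w.2 | w in K] !=set0.
Proof. by case: Kc => K0 _ _; eexists; exists (0, 0). Qed.

Lemma cone_inf_le_id v : cone_inf q K v <= q v.
Proof.
by case: Kc => K0 _ _; have := cone_inf_le v K0; rewrite addr0 subr0.
Qed.

(** This encodes the constraints of [K]: a linear [h <= cone_inf q K]
    satisfies [- h w <= - a], i.e. [a <= h w]. *)
Lemma cone_inf_opp w : K w -> cone_inf q K (- w.1) <= - w.2.
Proof.
by move=> /(cone_inf_le (- w.1)); rewrite addNr sublinear0// sub0r.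
Qed.

Lemma cone_inf_sublinear : sublinear (cone_inf q K).
Proof.
have [K0 KD KZ] := Kc; split=> [u v|t v].
  apply: le_infD; [exact: cone_inf_nonempty..|].
  move=> _ _ [w1 Kw1 <-] [w2 Kw2 <-].
  apply: le_trans (cone_inf_le _ (KD _ _ Kw1 Kw2)) _ => /=.
  by rewrite addrACA; have := qs.1 (u + w1.1) (v + w2.1); lra.
rewrite le_eqVlt => /predU1P[<-|t0].
  by rewrite scale0r mul0r; have := cone_inf_opp K0; rewrite /= !oppr0.
rewrite -ler_pdivrMl//; apply: lb_le_inf; first exact: cone_inf_nonempty.
move=> _ [w Kw <-]; rewrite ler_pdivrMl//.
apply: le_trans (cone_inf_le _ (KZ t _ (ltW t0) Kw)) _ => /=.
by rewrite -scalerDr mulrBr lerB// qs.2// ltW.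
Qed.

End cone_inf.

(** * The Hahn-Banach theorem *)

Lemma ray_convex_cone u a :
  convex_cone [set (t *: u, t * a) | t in [set t : R | 0 <= t]].
Proof.
split=> [|_ _ [s /= s0 <-] [t /= t0 <-]|t _ t0 [s /= s0 <-]] /=.
- by exists 0 => //=; rewrite scale0r mul0r.
- by exists (s + t); rewrite /= ?addr_ge0// scalerDl mulrDl.
- by exists (t * s); rewrite /= ?mulr_ge0// scalerA mulrA.
Qed.

(** Lowering [q] along the ray spanned by [(u, q u)] cannot change [q], so
    [q v <= q (v + u) - q u]. *)
Lemma minimal_sublinear_additive q : sublinear q ->
  (forall r, sublinear r -> (forall v, r v <= q v) -> forall v, q v <= r v) ->
  forall u v, q (u + v) = q u + q v.
Proof.
move=> qs qmin u v; apply/eqP; rewrite eq_le qs.1/=.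
pose K := [set (t *: u, t * q u) | t in [set t : R | 0 <= t]].
have Kc : convex_cone K by exact: ray_convex_cone.
have Kq w : K w -> w.2 <= q w.1 by move=> [t /= t0 <-]/=; rewrite sublinearZ.
have := qmin _ (cone_inf_sublinear qs Kc Kq) (cone_inf_le_id qs Kc Kq) v.
have Ku : K (u, q u) by exists 1; rewrite /= ?ler01// scale1r mul1r.
by have := cone_inf_le qs Kq v Ku => /=; rewrite (addrC v); lra.
Qed.

Lemma additive_sublinear_linear q : sublinear q ->
  (forall u v, q (u + v) = q u + q v) -> linear (q : X -> R^o).
Proof.
move=> qs qD.
have qN v : q (- v) = - q v.
  by apply/eqP; rewrite -addr_eq0 -qD addNr sublinear0.
move=> t u v; rewrite qD; congr (_ + _); rewrite -[RHS]/(t * q u).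
have [t0|t0] := leP 0 t; first exact: sublinearZ.
by rewrite -[t]opprK scaleNr qN sublinearZ ?mulNr// oppr_ge0 ltW.
Qed.

(** Subadditivity passes to the infimum because, of two functionals of a chain,
    the smaller one bounds both values at once. *)
Lemma chain_inf_sublinear p (A : set (X -> R)) : A !=set0 ->
  (forall q, A q -> sublinear q) -> (forall q, A q -> forall v, q v <= p v) ->
  (forall q1 q2, A q1 -> A q2 ->
     (forall v, q1 v <= q2 v) \/ (forall v, q2 v <= q1 v)) ->
  let s v := inf [set q v | q in A] in
  sublinear s /\ forall q, A q -> forall v, s v <= q v.
Proof.
move=> [q0 Aq0] As Ap Atot s.
have s_le q v : A q -> s v <= q v.
  move=> Aq; apply: ge_inf; last by exists q.
  (* [q v >= - q (- v) >= - p (- v)], uniformly in [q]. *)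
  exists (- p (- v)) => _ [r Ar <-].
  by have := sublinear_opp_ge v (As _ Ar); have := Ap r Ar (- v); lra.
have s0 v : [set q v | q in A] !=set0 by exists (q0 v), q0.
split; last by move=> q Aq v; exact: s_le.
split=> [u v|t v].
  apply: le_infD => // _ _ [q1 Aq1 <-] [q2 Aq2 <-].
  have [q12|q21] := Atot _ _ Aq1 Aq2.
    by have := s_le _ (u + v) Aq1; have := (As _ Aq1).1 u v; have := q12 v; lra.
  by have := s_le _ (u + v) Aq2; have := (As _ Aq2).1 u v; have := q21 u; lra.
rewrite le_eqVlt => /predU1P[<-|t0].
  by rewrite scale0r mul0r; have := s_le _ 0 Aq0; rewrite (sublinear0 (As _ Aq0)).
rewrite -ler_pdivrMl//; apply: lb_le_inf => // _ [q Aq <-].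
rewrite ler_pdivrMl//; apply: le_trans (s_le q _ Aq) _.
by apply: (As _ Aq).2; exact: ltW.
Qed.

Lemma minimal_sublinear_exists p : sublinear p ->
  exists q, [/\ sublinear q, forall v, q v <= p v &
    forall r, sublinear r -> (forall v, r v <= q v) -> forall v, q v <= r v].
Proof.
move=> ps.
pose T := {q : X -> R | sublinear q /\ forall v, q v <= p v}.
pose below (q r : T) := `[< forall v, sval r v <= sval q v >].
pose p0 : T := exist _ p (conj ps (fun v => lexx (p v))).
have [||A Atot|[q [qs qp]] qmin] := @ZL_preorder T p0 below.
- by move=> q; apply/asboolP => v.
- move=> q r s /asboolP rq /asboolP sr; apply/asboolP => v.
  exact: le_trans (sr v) (rq v).
- have [A0|] := pselect (A !=set0); last first.
    by move=> A0; exists p0 => s As; exfalso; apply: A0; exists s.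
  pose B : set (X -> R) := [set sval q | q in A].
  have [| | | |ss sle] := @chain_inf_sublinear p B.
  + by case: A0 => q Aq; exists (sval q), q.
  + by move=> _ [q _ <-]; exact: (svalP q).1.
  + by move=> _ [q _ <-]; exact: (svalP q).2.
  + move=> _ _ [q1 Aq1 <-] [q2 Aq2 <-].
    by have [/asboolP|/asboolP] := Atot _ _ Aq1 Aq2; [right|left].
  have sp v : inf [set q v | q in B] <= p v.
    case: A0 => q Aq; apply: le_trans ((svalP q).2 v).
    by apply: sle; exists q.
  exists (exist _ (fun v => inf [set q v | q in B]) (conj ss sp)) => q Aq.
  by apply/asboolP => v /=; apply: sle; exists q.
- exists q; split=> // r rs rq.
  have rp v : r v <= p v by exact: le_trans (rq v) (qp v).
  have := qmin (exist _ r (conj rs rp)).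
  by move=> /(_ (asboolT rq)) /asboolP.
Qed.

(** A minimal sublinear functional below [cone_inf p K] is linear, and being
    below [cone_inf p K] it satisfies all the constraints. *)
Lemma hahn_banach_cone p K : sublinear p -> convex_cone K ->
  (forall w, K w -> w.2 <= p w.1) ->
  exists h : X -> R, [/\ linear (h : X -> R^o), forall v, h v <= p v &
    forall w, K w -> w.2 <= h w.1].
Proof.
move=> ps Kc Kp.
have [h [hs hr hmin]] :=
  minimal_sublinear_exists (cone_inf_sublinear ps Kc Kp).
exists h; split=> [|v|w Kw].
- exact/additive_sublinear_linear/minimal_sublinear_additive.
- exact: le_trans (hr v) (cone_inf_le_id ps Kc Kp v).
- have := sublinear_opp_ge w.1 hs.
  by have := hr (- w.1); have := cone_inf_opp ps Kp Kw; lra.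
Qed.

End sublinear.

(** * The variational principle *)

(** Call [y] above [x] when [eps * |y - x| <= f y - f x].  This is an order for
    which [x0] is a maximal element of [C].  To reach one, climb greedily: each
    step gains at least half of what [f] can still gain above the current
    point.  The values of [f] increase to a limit, so the points form a Cauchy
    sequence, and since the gains tend to 0, nothing above its limit improves
    on [f]. *)
Lemma ekeland_point (R : realType) (X : completeNormedModType R)
    (C : set X) (f : X -> R) (eps : R) :
  C !=set0 -> closed C -> continuous f -> has_ubound (f @` C) -> 0 < eps ->
  exists2 x0, C x0 & forall y, C y -> f y - f x0 <= eps * `|y - x0|.
Proof.
move=> [c Cc] Ccl fcont [M fM] eps0.
pose above x y := C y /\ eps * `|y - x| <= f y - f x.
have above_refl x : C x -> above x x.
  by move=> Cx; split=> //; rewrite !subrr normr0 mulr0.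
have above_trans x y z : above x y -> above y z -> above x z.
  move=> [_ xy] [Cz yz]; split=> //.
  by have := ler_wpM2l (ltW eps0) (ler_distD y z x); lra.
have above_closed x : closed [set y | above x y].
  rewrite (_ : mkset _ =
      C `&` (fun y => f y - eps * `|y - x|) @^-1` [set t | f x <= t]); last first.
    by apply/seteqP; split=> y [Cy xy]; split=> //=; move: xy => /=; lra.
  apply: closedI => //; apply: preimage_closed; last exact: closed_ge.
  move=> y _; apply: cvgB; first exact: fcont.
  apply: cvgM; first exact: cvg_cst.
  by apply: cvg_norm; apply: cvgB; [exact: cvg_id|exact: cvg_cst].
(* Gaining at least half of what remains is stated without the supremum: no
   [z] above [x] exceeds [f y] by more than the gain [f y - f x]. *)
pose step (x y : {x | C x}) := above (sval x) (sval y) /\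
  forall z, above (sval x) z -> f z - f (sval y) <= f (sval y) - f (sval x).
have [u [_ ustep]] :
    {u : nat -> {x | C x} | u 0 = exist _ c Cc /\ forall n, step (u n) (u n.+1)}.
  apply: dependent_choice => -[x Cx]; apply/cid.
  pose E := f @` [set y | above x y].
  have Esup : has_sup E.
    split; first by exists (f x), x => //; exact: above_refl.
    by exists M => _ [y [Cy _] <-]; apply: fM; exists y.
  have fE z : above x z -> f z <= sup E.
    by move=> xz; apply: sup_upper_bound => //; exists z.
  have [xsup|supx] := ltP (f x) (sup E).
    have gap0 : 0 < (sup E - f x) / 2 by lra.
    have [_ [y xy <-] fy] := sup_adherent gap0 Esup.
    by exists (exist _ y xy.1); split=> //= z /fE; lra.
  by exists (exist _ x Cx); split=> [|z /fE /=]; [exact: above_refl|lra].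
pose x n := sval (u n).
have x_above m n : (m <= n)%N -> above (x m) (x n).
  elim: n => [|n IH]; first by rewrite leqn0 => /eqP ->; exact/above_refl/svalP.
  rewrite leq_eqVlt => /predU1P[->|/IH mn]; first exact/above_refl/svalP.
  exact: above_trans mn (ustep n).1.
have fx_nd : nondecreasing_seq (f \o x).
  move=> m n /x_above[_] /=.
  by have := mulr_ge0 (ltW eps0) (normr_ge0 (x n - x m)); lra.
have fx_cvg : cvgn (f \o x).
  apply: nondecreasing_is_cvgn => //.
  by exists M => _ [n _ <-]; apply: fM; exists (x n) => //; exact: svalP.
pose L := limn (f \o x).
have fxL n : f (x n) <= L by exact: (nondecreasing_cvgn_le fx_nd fx_cvg n).
have fx_near e : 0 < e -> exists n, L - f (x n) < e.
  move=> e0; have /cvgrPdist_lt/(_ e e0)[n _ /(_ n (leqnn n))] := fx_cvg.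
  by move=> /(le_lt_trans (ler_norm _)); exists n.
have x_cvg : cvgn x.
  apply/cauchy_cvgP; apply: cauchy_exP => e e0.
  have [n Ln] := fx_near (eps * e) (mulr_gt0 eps0 e0).
  exists (x n); exists n => // m /= nm; rewrite -ball_normE /= distrC.
  have [_ dist] := x_above _ _ nm.
  rewrite -(ltr_pM2l eps0); apply: le_lt_trans dist _.
  by have := fxL m; lra.
pose x0 := limn x.
have x0_above n : above (x n) x0.
  apply: (closed_cvg _ (above_closed (x n)) _ _ x_cvg).
  by exists n => // m /= nm; exact: x_above.
exists x0 => [|y Cy]; first by case: (x0_above 0).
rewrite leNgt; apply/negP => lt_y.
have x0y : above x0 y by split=> //; exact: ltW.
suff : f y <= f x0.
  by have := mulr_ge0 (ltW eps0) (normr_ge0 (y - x0)); lra.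
have -> : f x0 = L.
  by rewrite /L; apply/esym/cvg_lim => //; apply: continuous_cvg; [exact: fcont|].
apply/ler_addgt0Pr => e e0; have [n Ln] := fx_near _ e0.
have := (ustep n).2 y (above_trans _ _ _ (x0_above n) x0y).
by rewrite -/(x n) -/(x n.+1); have := fxL n.+1; lra.
Qed.

(** * Functionals bounded above on a set *)

Section support.
Context {R : realType} {X : normedModType R}.
Implicit Types (C : set X) (f : dual_space X).

Lemma support_domainP C f :
  C !=set0 -> support_domain C f <-> has_ubound (f @` C).
Proof.
move=> [c Cc]; split=> [fC|[M fM]].
  have fin : support_function C f \is a fin_num.
    rewrite fin_numE (lt_eqF fC) andbT gt_eqF//.
    by apply: lt_le_trans (ltNyr (f c)) _; apply: ereal_sup_ubound; exists c.
  exists (fine (support_function C f)) => _ [y Cy <-].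
  by rewrite -lee_fin fineK//; apply: ereal_sup_ubound; exists y.
apply: (@le_lt_trans _ _ M%:E); last exact: ltry.
by apply: ge_ereal_sup => _ [y Cy <-]; rewrite lee_fin fM//; exists y.
Qed.

Lemma normal_cone_support_function C a f :
  normal_cone C a f -> (f a)%:E = support_function C f.
Proof.
move=> [Ca fa]; apply/eqP; rewrite eq_le; apply/andP; split.
  by apply: ereal_sup_ubound; exists a.
apply: ge_ereal_sup => _ [y Cy <-]; rewrite lee_fin -subr_le0 -linearB.
exact: fa.
Qed.

Lemma bounded_has_ubound_dual C f : bounded_set C -> has_ubound (f @` C).
Proof.
move=> /pinfty_ex_gt0[M M0 CM].
have /linear_boundedP/pinfty_ex_gt0[K K0 fK] :
    bounded_near (f : {linear X -> R^o}) (nbhs 0).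
  exact/linear_bounded_continuous/dual_continuous.
exists (K * M) => _ [y Cy <-].
apply: le_trans (ler_norm _) _; apply: le_trans (fK y) _.
by rewrite (ler_wpM2l (ltW K0))//; exact: CM.
Qed.

(** * The Bishop-Phelps theorem *)

(** A one-sided bound on a linear functional is two-sided, hence a bound on its
    dual norm. *)
Lemma dual_of_dominated (h : X -> R) (M : R) :
  0 <= M -> linear (h : X -> R^o) -> (forall v, h v <= M * `|v|) ->
  exists h' : dual_space X, (forall v, h' v = h v) /\ `|h'| <= M.
Proof.
move=> M0 hlin hM.
pose lh := GRing.isLinear.Build R X R^o *:%R (h : X -> R^o) hlin.
pose hl : {linear X -> R^o} := HB.pack (h : X -> R^o) lh.
have hN v : h (- v) = - h v by exact: (linearN hl v).
have abs_h v : `|h v| <= M * `|v|.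
  by rewrite ler_norml hM andbT lerNl -hN -normrN hM.
have hcont : continuous (h : X -> R^o).
  apply/(linear_bounded_continuous hl)/linear_boundedP.
  apply: filterS (nbhs_pinfty_ge (num_real M)) => r Mr v.
  by apply: le_trans (abs_h v) _; rewrite ler_wpM2r.
have hdual : (h : X -> R^o) \in @dual_pred R X by rewrite inE.
exists (Dual hdual); split=> //; apply: dual_norm_le => v v1.
by apply: le_trans (abs_h v) _; rewrite ler_piMr.
Qed.

(** Constraining a linear functional to be above [f] on [C - x0] amounts to
    constraining it on the cone spanned by [C - x0], convex because [C] is. *)
Lemma translated_convex_cone C f x0 : C x0 -> convex_set C ->
  convex_cone [set (t *: (y - x0), t * f (y - x0)) |
                t in [set t : R | 0 <= t] & y in C].
Proof.
move=> Cx0 Ccvx; split.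
- by exists 0 => //=; exists x0; rewrite // scale0r mul0r.
- move=> _ _ [s /= s0 [y Cy <-]] [t /= t0 [z Cz <-]] /=.
  have [st0|st0] := eqVneq (s + t) 0.
    have [-> ->] : s = 0 /\ t = 0 by lra.
    by exists 0 => //=; exists x0; rewrite // !scale0r !mul0r !addr0.
  have st_gt0 : 0 < s + t by rewrite lt_neqAle eq_sym st0 addr_ge0.
  have k0 : 0 <= s / (s + t) by rewrite divr_ge0// ltW.
  have k1 : s / (s + t) <= 1 by rewrite ler_pdivrMr// mul1r lerDl.
  have kC : s / (s + t) *: y + (1 - s / (s + t)) *: z \in C.
    by have := Ccvx y z (Itv01 k0 k1); rewrite !inE; apply.
  have comb : (s + t) *: (s / (s + t) *: y + (1 - s / (s + t)) *: z - x0) =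
      s *: (y - x0) + t *: (z - x0).
    have sE : (s + t) * (s / (s + t)) = s by rewrite mulrC divfK.
    have tE : (s + t) * (1 - s / (s + t)) = t by rewrite mulrBr sE; lra.
    rewrite scalerBr scalerDr !scalerA sE tE.
    by rewrite !scalerBr scalerDl opprD addrACA.
  exists (s + t); first exact: addr_ge0.
  exists (s / (s + t) *: y + (1 - s / (s + t)) *: z); first by rewrite inE in kC.
  rewrite comb; congr (_, _).
  have fZ (a : R) v : f (a *: v) = a * f v by exact: linearZ.
  by rewrite -!fZ comb linearD.
- move=> t _ t0 [s /= s0 [y Cy <-]] /=.
  by exists (t * s); rewrite /= ?mulr_ge0//; exists y; rewrite // scalerA mulrA.
Qed.

End support.

Theorem bishop_phelps (R : realType) (X : completeNormedModType R)
    (C : set X) (f : dual_space X) (eps : R) :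
  C !=set0 -> closed C -> convex_set C -> support_domain C f -> 0 < eps ->
  exists (g : dual_space X) (x0 : X), normal_cone C x0 g /\ `|f - g| <= eps.
Proof.
move=> C0 Ccl Ccvx fC eps0.
have fub : has_ubound (f @` C) by exact/support_domainP.
have [x0 Cx0 x0max] := ekeland_point C0 Ccl (@dual_continuous _ _ f) fub eps0.
have norm_sub : sublinear (fun v : X => eps * `|v|).
  split=> [u v|t v t0].
    by rewrite -mulrDr ler_wpM2l ?ler_normD// ltW.
  by rewrite normrZ ger0_norm// mulrCA.
have [|h [hlin heps hC]] :=
    hahn_banach_cone norm_sub (translated_convex_cone f Cx0 Ccvx).
  move=> _ [t /= t0 [y Cy <-]] /=; rewrite normrZ ger0_norm// mulrCA.
  by rewrite ler_wpM2l// linearB x0max.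
have [h' [h'E h'eps]] := dual_of_dominated (ltW eps0) hlin heps.
exists (f - h'), x0; split; last by rewrite subKr.
split=> // y Cy; rewrite -[(f - h') _]/(f (y - x0) - h' (y - x0)) h'E subr_le0.
apply: (hC (y - x0, f (y - x0))); exists 1; first exact: ler01.
by exists y; rewrite // scale1r mul1r.
Qed.

Theorem corollary12 (R : realType) (X : completeNormedModType R)
    (X_nontrivial : exists x : X, x != 0) :
  (forall C : set X,
     C !=set0 -> closed C -> convex_set C -> bounded_set C ->
     dense (support_functionals C))
  /\
  (forall C : set X,
     C !=set0 -> closed C -> convex_set C ->
     (support_functionals C `<=` support_domain C /\
      support_domain C `<=` closure (support_functionals C))
     /\
     (forall (eps : R) (f : dual_space X),
        0 < eps -> (support_function C f < +oo)%E ->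
        exists (g : dual_space X) (x0 : X),
          [/\ C x0, (g x0)%:E = support_function C g,
              normal_cone C x0 g & `|f - g| <= eps])).
Proof.
have dom_closure (C : set X) : C !=set0 -> closed C -> convex_set C ->
    support_domain C `<=` closure (support_functionals C).
  move=> C0 Ccl Ccvx f fC U /nbhs_ballP[e /= e0 eU].
  have e20 : 0 < e / 2 by rewrite divr_gt0.
  have [g [x0 [gN fg]]] := bishop_phelps C0 Ccl Ccvx fC e20.
  exists g; split; first by exists x0 => //; exact: gN.1.
  by apply: eU; rewrite -ball_normE /=; apply: le_lt_trans fg _; lra.
split=> [C C0 Ccl Ccvx Cbd|C C0 Ccl Ccvx].
  move=> O [f Of] Oopen; rewrite setIC.
  apply: (dom_closure C C0 Ccl Ccvx f _ O (open_nbhs_nbhs (conj Oopen Of))).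
  exact/(support_domainP _ C0)/bounded_has_ubound_dual.
split; first split.
- move=> f [a Ca fa]; rewrite /support_domain /=.
  by rewrite -(normal_cone_support_function fa) ltry.
- exact: dom_closure.
move=> eps f eps0 fC.
have [g [x0 [gN fg]]] := bishop_phelps C0 Ccl Ccvx fC eps0.
exists g, x0; split=> //; first exact: gN.1.
exact: normal_cone_support_function.
Qed.
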